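(* Let $g\in\mathcal F'_{\alpha,\beta,k}(L,L_f,G,G_g,\bar L)$. For any $x_t\in\Theta$ and $h\in(0,1]$, the gradient estimator $\tilde g_t$ defined in the context satisfies $$\mathbb E\bigl[\|\tilde g_t\|^2\mid x_t\bigr]\le4G^2+4d\,C_{\mathrm{bias}}^2\,h^{2(\beta-1)}+2d\,C_{\mathrm{var}}\,h^{-2(k+1)},$$ where $$C_{\mathrm{var}}:=\frac{\mathbb E[K_k(U)^2]\,\mathbb E[K_1(V)^2]}{4}\Bigl(\frac{3\bar L^2}{16}+6G_g^2+8\sigma^2\Bigr),\qquad C_{\mathrm{bias}}:=L\,\bigl(\mathbb E[K_k(U)^2]\bigr)^{1/2}\bigl(\mathbb E[K_1(V)^2]\bigr)^{1/2},$$ with $U,V$ uniform on $[-1/2,1/2]$.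
   Context: **General notation.** $\|\cdot\|$ and $\langle\cdot,\cdot\rangle$ are the Euclidean norm and inner product on $\mathbb R^d$. $\Theta\subset\mathbb R^d$ is a compact convex set with non-empty interior, $\Pi_\Theta$ is the Euclidean projection onto $\Theta$, and $\Theta^+:=\{x\in\mathbb R^d:\mathrm{dist}(x,\Theta)\le 1\}$, where $\mathrm{dist}$ is the Euclidean distance. An integer $k\in\{0,1,2,\dots\}$ and a coordinate $j\in\{1,\dots,d\}$ are fixed; $e_l$ is the $l$-th canonical basis vector; $\partial_j^k$ is the $k$-th order partial derivative in the $j$-th coordinate, with $\partial_j^0 g:=g$. $\lfloor\beta\rfloor$ denotes the largest integer strictly less than $\beta$. **Hölder class.** For $\beta,L>0$ and $\ell=\lfloor\beta\rfloor$, $\mathcal F_\beta(L)$ is the set of functions $\phi:\mathbb R^d\to\mathbb R$ that are $\ell$ times continuously differentiable and satisfy $\bigl|\phi(z)-\sum_{|m|\le\ell}\frac1{m!}D^m\phi(x)(z-x)^m\bigr|\le L\|z-x\|^\beta$ for all $x,z\in\mathbb R^d$ ($m$ a multi-index). **Strong convexity.** A continuously differentiable $f$ is $\alpha$-strongly convex on a convex set $S$ if $f(y)\ge f(x)+\langle\nabla f(x),y-x\rangle+\frac\alpha2\|y-x\|^2$ for all $x,y\in S$. **Function class.** For parameters $\alpha,L,L_f,G,G_g,\bar L>0$ and $\beta>1$, $\mathcal F'_{\alpha,\beta,k}(L,L_f,G,G_g,\bar L)$ is the set of all $g:\mathbb R^d\to\mathbb R$ such that, with $f:=\partial_j^k g$: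 (a) $g\in\mathcal F_{\beta+k}(L)$; (b) $f$ is $\alpha$-strongly convex on $\Theta$; (c) $\nabla f$ is $L_f$-Lipschitz on $\Theta$ with respect to the Euclidean norm; (d) $\|\nabla f(x)\|\le G$ for all $x\in\Theta$; (e) $\|\nabla g(x)\|\le G_g$ for all $x\in\Theta^+$; (f) $\nabla g$ is $\bar L$-Lipschitz on $\Theta^+$ with respect to the Euclidean norm; (g) $f$ attains its minimum on $\Theta$ at a point $x^\star\in\mathrm{int}(\Theta)$. **Kernels.** Let $\ell_*:=\lfloor\beta+k\rfloor=k+\lfloor\beta\rfloor$. Two bounded kernels $K_k,K_1:[-1/2,1/2]\to\mathbb R$ are given ($K_k$ is associated with the derivative direction $j$ and $K_1$ with the gradient direction $l$; they are two separate kernels, each with its own conditions) such that $\int u^aK_k(u)\,du=0$ for $a\in\{0,\dots,\ell_*\}\setminus\{k\}$ and $\int u^kK_k(u)\,du=k!$; and $\int v^bK_1(v)\,dv=0$ for $b=0$ and for odd $b\in\{3,5,\dots,\ell_*\}$, and $\int vK_1(v)\,dv=1$. **Oracle and gradient estimator.** The algorithm runs over steps $t\in\{0,\dots,T-1\}$ with the projected recursion $x_{t+1}:=\Pi_\Theta(x_t-\eta_t\tilde g_t)$, started at an arbitrary $x_0\in\Theta$, with step sizes $\eta_t>0$. At step $t$, given the current iterate $x_t\in\Theta$ and a smoothing parameter $h>0$, for each $l\in\{1,\dots,d\}$ one observes $$y^{+}_{t,l}=g(x_t+hU_{t,l}e_j+hV_{t,l}e_l)+\varepsilon^{+}_{t,l},\qquad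 y^{-}_{t,l}=g(x_t+hU_{t,l}e_j-hV_{t,l}e_l)+\varepsilon^{-}_{t,l}.$$ The randomization variables $U_{t,l},V_{t,l}$, chosen by the learner, are i.i.d. uniform on $[-1/2,1/2]$, and the noise variables satisfy $\mathbb E[(\varepsilon^\pm_{t,l})^2]\le\sigma^2$. The set of all randomization variables $(U_{t,l},V_{t,l})$ is independent of the set of all noise variables $(\varepsilon^\pm_{t,l})$. No independence or zero-mean assumption is imposed on the noises $\varepsilon^\pm_{t,l}$. The estimator is $\tilde g_t=(\tilde g_{t,1},\dots,\tilde g_{t,d})\in\mathbb R^d$ with $$\tilde g_{t,l}:=\frac{K_k(U_{t,l})K_1(V_{t,l})}{2h^{k+1}}\bigl(y^+_{t,l}-y^-_{t,l}\bigr),\qquad l=1,\dots,d.$$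
   Formalization: For x_t a fixed point of Θ the bound is proved as stated; for the random iterate x_t, the noise bound is assumed conditionally, E[(ε^±_{t,l})²|x_t] ≤ σ² a.s., since dependent noises can make the conditional claim false under E[(ε^±_{t,l})²] ≤ σ² alone. *)

(* Defs.v *)
From HB Require Import structures.
From mathcomp Require Import all_boot all_order all_algebra.
From mathcomp Require Import all_classical all_reals all_analysis.

Set Implicit Arguments.
Unset Strict Implicit.
Unset Printing Implicit Defensive.

Import Order.TTheory GRing.Theory Num.Theory.
Import numFieldNormedType.Exports.

Local Open Scope classical_set_scope.
Local Open Scope ring_scope.

(* The points of R^d are row vectors.  The library norm on 'rV[R]_d is the sup
   norm, hence the separate Euclidean norm; both induce the same topology. *)
Section Euclidean.
Context {R : realType} {d : nat}.
Implicit Types (x y v : 'rV[R]_d) (S : set 'rV[R]_d).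

Definition edot x y : R := \sum_i x 0 i * y 0 i.
Definition enorm x : R := Num.sqrt (edot x x).

(* Meaningful for S nonempty (inf set0 = 0). *)
Definition edist x S : R := inf [set enorm (x - y) | y in S].

Definition enlarge S : set 'rV[R]_d := [set x | edist x S <= 1].

(* p is the Euclidean projection of y onto S. *)
Definition is_proj S y p : Prop :=
  S p /\ forall z, S z -> enorm (y - p) <= enorm (y - z).

Definition elipschitz (c : R) S (F : 'rV[R]_d -> 'rV[R]_d) : Prop :=
  forall x y, S x -> S y -> enorm (F x - F y) <= c * enorm (x - y).

End Euclidean.

(* The largest integer strictly less than b, for b > 0
   (so not Num.floor b when b is an integer). *)
Definition sfloor {R : realType} (b : R) : nat := `|Num.ceil b - 1|%N.

Lemma sfloorP {R : realType} (b : R) :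
  0 < b -> (sfloor b)%:R < b /\ b <= (sfloor b).+1%:R.
Proof.
move=> b0; have c1 : (1 <= Num.ceil b)%R by rewrite -gtz0_ge1 ceil_gt0.
have eN : ((sfloor b)%:R : R) = (Num.ceil b - 1)%:~R.
  by rewrite /sfloor pmulrn gez0_abs ?subr_ge0.
split; first by rewrite eN ceilB1_lt.
by rewrite -natr1 eN rmorphB/= subrK ceil_ge.
Qed.

Section Derivatives.
Context {R : realType} {d : nat}.
Implicit Types (f : 'rV[R]_d -> R) (x y v : 'rV[R]_d) (i j : 'I_d).

Definition evec i : 'rV[R]_d := delta_mx 0 i.

Definition partial i f : 'rV[R]_d -> R := fun x => 'D_(evec i) f x.

Definition grad f x : 'rV[R]_d := \row_i partial i f x.

Definition partialn i n f : 'rV[R]_d -> R := iter n (partial i) f.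

Fixpoint Ck n f : Prop :=
  if n is n'.+1 then
    (forall x, differentiable f x) /\ (forall i, Ck n' (partial i f))
  else continuous f.

(* Multi-indices of length at most n have all their entries at most n. *)
Definition mindex n := {ffun 'I_d -> 'I_n.+1}.
Definition msize n (m : mindex n) : nat := (\sum_i m i)%N.
Definition mfact n (m : mindex n) : nat := (\prod_i (m i)`!)%N.
Definition mpow n (m : mindex n) v : R := \prod_i v 0 i ^+ m i.
Definition mderiv n (m : mindex n) f : 'rV[R]_d -> R :=
  foldr (fun i h => partialn i (m i) h) f (enum 'I_d).

Definition taylor n f x z : R :=
  \sum_(m : mindex n | (msize m <= n)%N)
     (mfact m)%:R^-1 * mderiv m f x * mpow m (z - x).

Definition holder (b L : R) f : Prop :=
  Ck (sfloor b) f /\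
  forall x z, `|f z - taylor (sfloor b) f x z| <= L * enorm (z - x) `^ b.

Definition strongly_convex (a : R) (S : set 'rV[R]_d) f : Prop :=
  Ck 1 f /\
  forall x y, S x -> S y ->
    f x + edot (grad f x) (y - x) + a / 2 * enorm (y - x) ^+ 2 <= f y.

(* The class F'_{a,b,k}(L, Lf, G, Gg, Lbar) relative to the constraint set S
   and the coordinate j. *)
Record in_class (S : set 'rV[R]_d) j (a b : R) (k : nat)
    (L Lf G Gg Lbar : R) (g : 'rV[R]_d -> R) : Prop := InClass {
  class_holder : holder (b + k%:R) L g ;
  class_convex : strongly_convex a S (partialn j k g) ;
  class_gradf_lip : elipschitz Lf S (grad (partialn j k g)) ;
  class_gradf_bound :
    forall x, S x -> enorm (grad (partialn j k g) x) <= G ;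
  class_gradg_bound : forall x, enlarge S x -> enorm (grad g x) <= Gg ;
  class_gradg_lip : elipschitz Lbar (enlarge S) (grad g) ;
  class_min : exists2 xs, interior S xs &
    forall y, S y -> partialn j k g xs <= partialn j k g y }.

End Derivatives.

Section Kernels.
Context {R : realType}.
Implicit Types (K : R -> R).

Lemma Nhalf_lt_half : - 2^-1 < 2^-1 :> R.
Proof. by rewrite gtrN// invr_gt0. Qed.

Definition unif : probability (measurableTypeR R) R := uniform_prob Nhalf_lt_half.

(* A bounded kernel on [-1/2, 1/2], identified with its extension by 0. *)
Definition kernel_on K : Prop :=
  [/\ measurable_fun setT K,
      forall u, u \notin `[- 2^-1, 2^-1] -> K u = 0
    & exists M : R, forall u, `|K u| <= M].

Definition kmoment K (a : nat) : \bar R :=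
  (\int[lebesgue_measure]_(u in `[(- 2^-1)%R, (2^-1)%R]) (u ^+ a * K u)%:E)%E.

Definition deriv_kernel (k n : nat) K : Prop :=
  [/\ kernel_on K,
      forall a, (a <= n)%N -> a != k -> kmoment K a = 0%E
    & kmoment K k = (k`!%:R)%:E].

Definition grad_kernel (n : nat) K : Prop :=
  [/\ kernel_on K,
      kmoment K 0 = 0%E,
      forall b, odd b -> (3 <= b <= n)%N -> kmoment K b = 0%E
    & kmoment K 1 = 1%:E].

(* E[K(U)^2] for U uniform on [-1/2, 1/2]; finite because K is bounded. *)
Definition ksqmean K : R := fine ('E_unif[fun u => (K u ^+ 2)%R])%E.

Definition Cvar Kk K1 (Lbar Gg sigma : R) : R :=
  ksqmean Kk * ksqmean K1 / 4 *
    (3 * Lbar ^+ 2 / 16 + 6 * Gg ^+ 2 + 8 * sigma ^+ 2).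

Definition Cbias Kk K1 (L : R) : R :=
  L * Num.sqrt (ksqmean Kk) * Num.sqrt (ksqmean K1).

End Kernels.

Section Probability.
Context {R : realType} {dd : measure_display} {Omega : measurableType dd}.
Variable P : probability Omega R.

Definition gen_sigma (I : Type) (X : I -> Omega -> R) : set (set Omega) :=
  <<s \bigcup_i preimage_set_system setT (X i) measurable >>.

Definition mutually_independent (I : finType) (X : I -> Omega -> R) : Prop :=
  forall (J : {set I}) (B : I -> set R), (forall i, measurable (B i)) ->
    P (\bigcap_(i in [set` J]) (X i @^-1` B i)) =
    (\prod_(i in J) P (X i @^-1` B i))%E.

Definition independent_families (I I' : Type)
    (X : I -> Omega -> R) (Y : I' -> Omega -> R) : Prop :=
  forall A B, gen_sigma X A -> gen_sigma Y B -> P (A `&` B) = (P A * P B)%E.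

Definition uniform_law (X : Omega -> R) : Prop :=
  forall B : set R, measurable B -> P (X @^-1` B) = unif B.

(* Z is a version of E[Y | X], where X is a family of random variables (for a
   random vector, the family of its coordinates). *)
Definition is_cond_exp (I : Type) (X : I -> Omega -> R) (Y Z : Omega -> R) :=
  [/\ P.-integrable setT (EFin \o Y), P.-integrable setT (EFin \o Z),
      forall B : set R, measurable B -> gen_sigma X (Z @^-1` B)
    & forall A, gen_sigma X A ->
        (\int[P]_(w in A) (Z w)%:E = \int[P]_(w in A) (Y w)%:E)%E].

(* E[Y | X] <= c almost surely; versions being a.s. equal, the choice of one
   is immaterial. *)
Definition cond_exp_le (I : Type) (X : I -> Omega -> R) (Y : Omega -> R)
    (c : R) : Prop :=
  exists2 Z, is_cond_exp X Y Z & {ae P, forall w, Z w <= c}.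

Definition coords (d : nat) (X : Omega -> 'rV[R]_d) : 'I_d -> Omega -> R :=
  fun i w => X w 0 i.

(* All the variables A t l and B t l as a single family. *)
Definition merge_families (T d : nat) (A B : 'I_T -> 'I_d -> Omega -> R) :
    'I_T * 'I_d * bool -> Omega -> R :=
  fun i => if i.2 then A i.1.1 i.1.2 else B i.1.1 i.1.2.

(* The learner draws U, V; the oracle adds the noises ep (+) and em (-). *)
Record oracle_model (T d : nat) (sigma : R)
    (U V ep em : 'I_T -> 'I_d -> {RV P >-> R}) : Prop := OracleModel {
  rand_indep : mutually_independent (merge_families U V) ;
  rand_unifU : forall s l, uniform_law (U s l) ;
  rand_unifV : forall s l, uniform_law (V s l) ;
  noise_plus : forall s l,
    ('E_P[fun w => (ep s l w ^+ 2)%R] <= (sigma ^+ 2)%:E)%E ;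
  noise_minus : forall s l,
    ('E_P[fun w => (em s l w ^+ 2)%R] <= (sigma ^+ 2)%:E)%E ;
  rand_noise_indep :
    independent_families (merge_families U V) (merge_families ep em) }.

End Probability.

Section Estimator.
Context {R : realType} {d : nat}.
Variables (g : 'rV[R]_d -> R) (Kk K1 : R -> R) (k : nat) (j : 'I_d).

Definition grad_est (h : R) (x : 'rV[R]_d) (u v ep em : 'I_d -> R) :
    'rV[R]_d :=
  \row_l (Kk (u l) * K1 (v l) / (2 * h ^+ k.+1) *
    ((g (x + (h * u l) *: evec j + (h * v l) *: evec l) + ep l) -
     (g (x + (h * u l) *: evec j - (h * v l) *: evec l) + em l))).

Context {dd : measure_display} {Omega : measurableType dd}.
Variables (P : probability Omega R) (T : nat).
Variables (U V ep em : 'I_T -> 'I_d -> {RV P >-> R}).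

(* The estimator of step s queried around the point x. *)
Definition step_est (s : 'I_T) (h : R) (x : 'rV[R]_d) (w : Omega) : 'rV[R]_d :=
  grad_est h x (fun l => U s l w) (fun l => V s l w)
    (fun l => ep s l w) (fun l => em s l w).

Definition projected_recursion (S : set 'rV[R]_d) (eta h : nat -> R)
    (x0 : 'rV[R]_d) (x : nat -> Omega -> 'rV[R]_d) : Prop :=
  (forall w, x 0%N w = x0) /\
  forall (s : 'I_T) w,
    is_proj S (x s w - eta s *: step_est s (h s) (x s w) w) (x s.+1 w).

End Estimator.

(* Main.v *)
(* The smoothing bias plays no role: the variance term alone dominates.  By the
   mean value theorem along e_l and |grad g| <= Gg on the unit enlargement of
   Theta, the two exact queries differ by at most Gg, wherever the kernels do not
   vanish.  Hence, pointwise,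
     ghat_l^2 <= Kk(U)^2 K1(V)^2 (2 Gg^2 + 4 (eps+)^2 + 4 (eps-)^2) / (4 h^(2k+2)).
   The current iterate is a measurable function of the past draws, because the
   projection is nonexpansive, so U and V are independent of each other and of
   the pair (iterate, noise), and the kernel factors integrate out.  Integrating
   over the events of the iterate gives the conditional bound, the conditional
   expectation itself being a Radon-Nikodym derivative. *)
Require Import Defs.
From HB Require Import structures.
From mathcomp Require Import all_boot all_order all_algebra.
From mathcomp Require Import ring lra.
From mathcomp Require Import all_classical all_reals all_analysis.
From mathcomp Require Import measurable_realfun.

Set Implicit Arguments.
Unset Strict Implicit.
Unset Printing Implicit Defensive.

Import Order.TTheory GRing.Theory Num.Theory.
Import numFieldNormedType.Exports.

Local Open Scope classical_set_scope.
Local Open Scope ring_scope.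

(** * Euclidean geometry and projection onto a compact convex set *)

Section EuclideanTheory.
Context {R : realType} {d : nat}.
Implicit Types (x y v : 'rV[R]_d) (S : set 'rV[R]_d).

Lemma edotC x y : edot x y = edot y x.
Proof. by apply: eq_bigr => i _; rewrite mulrC. Qed.

Lemma edotDl x y v : edot (x + y) v = edot x v + edot y v.
Proof. by rewrite /edot -big_split; apply: eq_bigr => i _; rewrite !mxE mulrDl. Qed.

Lemma edotZl (a : R) x y : edot (a *: x) y = a * edot x y.
Proof. by rewrite /edot mulr_sumr; apply: eq_bigr => i _; rewrite !mxE mulrA. Qed.

Lemma edotBl x y v : edot (x - y) v = edot x v - edot y v.
Proof. by rewrite edotDl -scaleN1r edotZl mulN1r. Qed.

Lemma edotDr x y v : edot v (x + y) = edot v x + edot v y.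
Proof. by rewrite edotC edotDl !(edotC v). Qed.

Lemma edotBr x y v : edot v (x - y) = edot v x - edot v y.
Proof. by rewrite edotC edotBl !(edotC v). Qed.

Lemma edotZr (a : R) x y : edot x (a *: y) = a * edot x y.
Proof. by rewrite edotC edotZl edotC. Qed.

Lemma edot_ge0 x : 0 <= edot x x.
Proof. by apply: sumr_ge0 => i _; rewrite -expr2 sqr_ge0. Qed.

Lemma enorm_ge0 x : 0 <= enorm x.
Proof. exact: sqrtr_ge0. Qed.

Lemma sqr_enorm x : enorm x ^+ 2 = edot x x.
Proof. by rewrite sqr_sqrtr ?edot_ge0. Qed.

Lemma ler_enorm x y : (enorm x <= enorm y) = (edot x x <= edot y y).
Proof. by rewrite /enorm ler_sqrt ?edot_ge0. Qed.

Lemma enorm_coord x i : `|x 0 i| <= enorm x.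
Proof.
rewrite -sqrtr_sqr ler_sqrt ?edot_ge0// /edot (bigD1 i)//= -expr2 lerDl.
by apply: sumr_ge0 => j _; rewrite -expr2 sqr_ge0.
Qed.

Lemma edot_evec (i j : 'I_d) : edot (evec i) (evec j : 'rV[R]_d) = (i == j)%:R.
Proof.
rewrite /edot (bigD1 i)//= big1 => [|l li]; rewrite !mxE !eqxx/=.
  by rewrite mul1r addr0.
by rewrite (negbTE li) mul0r.
Qed.

Lemma continuous_enorm : continuous (@enorm R d).
Proof.
move=> x; apply: (@continuous_comp _ _ _ (fun x => edot x x) Num.sqrt).
  have c (i : 'I_d) : continuous (fun v : 'rV[R]_d => v 0 i * v 0 i).
    by move=> z; apply: continuousM; exact: coord_continuous.
  by apply: (continuous_big add_continuous) => i _; exact: c.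
exact: sqrt_continuous.
Qed.

Lemma continuous_enormB y : continuous (fun z : 'rV[R]_d => enorm (y - z)).
Proof.
move=> z; apply: (@continuous_comp _ _ _ (fun z : 'rV[R]_d => y - z) enorm).
  by apply: (@continuousB _ _ _ (fun=> y) id); [exact: cst_continuous|move=> ?].
exact: continuous_enorm.
Qed.

Lemma enlarge_shift S x v : S x -> enorm v <= 1 -> enlarge S (x + v).
Proof.
move=> Sx v1; rewrite /enlarge/= /edist; apply: le_trans v1.
apply: ge_inf; first by exists 0 => _ [y _ <-]; exact: enorm_ge0.
by exists x => //; rewrite addrC addKr.
Qed.

(* Moving from the projection p towards z by a small step s cannot decrease the
   distance to y, so 2 <y - p, z - p> <= s |z - p|^2. *)
Lemma is_proj_obtuse S y p : convex_set S -> is_proj S y p ->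
  forall z, S z -> edot (y - p) (z - p) <= 0.
Proof.
move=> cS [Sp pmin] z Sz; rewrite leNgt; apply/negP => a0.
set a := edot _ _ in a0; set b := edot (z - p) (z - p).
have b0 : 0 <= b by exact: edot_ge0.
have ab0 : 0 < a + b by rewrite ltr_wpDr.
(* Minimality at [p] will give [2 * a <= s * b]. With this [s], which lies in []0, 1]] even when
   [b = 0], it becomes [2 * a * (a + b) <= a * b], impossible for [a > 0] and [b >= 0]. *)
set s := a / (a + b).
have s0 : 0 < s by rewrite divr_gt0.
have s1 : s <= 1 by rewrite ler_pdivrMr// mul1r lerDl.
have Sps : S (p + s *: (z - p)).
  have := cS z p (Itv01 (ltW s0) s1).
  rewrite !inE => /(_ Sz Sp); rewrite /conv/= /unstable.onem scalerBl scale1r.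
  by rewrite scalerBr addrCA.
have H : 2 * a <= s * b.
  have := pmin _ Sps; rewrite ler_enorm opprD addrA.
  rewrite /a /b; move: (y - p) (z - p) => u w.
  rewrite edotBl !edotBr !edotZr !edotZl (edotC w) => H.
  by rewrite -(ler_pM2l s0); lra.
move: H.
rewrite /s mulrAC ler_pdivlMr// => {}H.
have : 2 * a * (a + b) = a * b + (2 * a * a + a * b) by ring.
move=> E; move: H; rewrite E gerDl; apply/negP; rewrite -ltNge.
by rewrite ltr_wpDr ?mulr_ge0 ?mulr_gt0// ltW.
Qed.

(** With [u = y - y'] and [w = p - p'], adding the obtuse-angle inequalities at [p] and [p'] gives
    [|w|^2 <= <u, w>]; expanding [|u - w|^2 >= 0] then yields [|w|^2 <= |u|^2] without
    Cauchy-Schwarz. *)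
Lemma is_proj_nonexpansive S y y' p p' : convex_set S ->
  is_proj S y p -> is_proj S y' p' -> enorm (p - p') <= enorm (y - y').
Proof.
move=> cS pp pp'; rewrite ler_enorm.
have := is_proj_obtuse cS pp pp'.1; have := is_proj_obtuse cS pp' pp.1.
have := edot_ge0 ((y - y') - (p - p')).
have -> : edot (y' - p') (p - p') = edot (p - p') (p - p') -
    edot (y - y') (p - p') + edot (y - p) (p - p').
  rewrite -!edotBl -edotDl; congr edot.
  by apply/rowP => i; rewrite !mxE; lra.
have -> : edot (y - p) (p' - p) = - edot (y - p) (p - p').
  by rewrite -(opprB p p') -[X in edot _ X]scaleN1r edotZr mulN1r.
move: (edot (y - p) _) => e; move: (y - y') (p - p') => u w.
by rewrite edotBl !edotBr (edotC w u); lra.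
Qed.

Lemma is_proj_exists S y : compact S -> S !=set0 -> exists p, is_proj S y p.
Proof.
move=> cS S0.
have [|p Sp pmin] := @compact_EVT_min _ _ (fun z : 'rV[R]_d => enorm (y - z)) S S0 cS.
  by apply: continuous_subspaceT; exact: continuous_enormB.
by exists p; split => [|z Sz]; [exact: set_mem|apply: pmin; exact: mem_set].
Qed.

(** The projection as a total function. The default 0 is taken only when no projection exists, which
    [eprojP] excludes for compact nonempty [S]. *)
Definition eproj S y : 'rV[R]_d := xget 0 [set p | is_proj S y p].

Lemma eprojP S y : compact S -> S !=set0 -> is_proj S y (eproj S y).
Proof. by move=> cS S0; have [p pp] := is_proj_exists y cS S0; exact: (xgetI 0 pp). Qed.

(** Nonexpansiveness with [y = y'] puts any two projections of [y] at distance 0. *)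
Lemma eproj_unique S y p : convex_set S -> is_proj S y p -> p = eproj S y.
Proof.
move=> cS pp; have qq : is_proj S y (eproj S y) by exact: (xgetI 0 pp).
apply/subr0_eq/rowP => i; rewrite [RHS]mxE; apply/eqP; rewrite -normr_le0.
rewrite (le_trans (enorm_coord _ i))// (le_trans (is_proj_nonexpansive cS pp qq))//.
rewrite subrr /enorm /edot big1 ?sqrtr0// => l _; by rewrite mxE mul0r.
Qed.

Lemma continuous_eproj S i : compact S -> convex_set S -> S !=set0 ->
  continuous (fun y => eproj S y 0 i).
Proof.
move=> cS vS S0 y.
apply/(@cvgrPdist_le _ _ _ (nbhs y) (nbhs_filter y)) => /= e e0.
have := @continuous_enormB y y; rewrite /continuous_at subrr => h.
have := @cvgr_dist_le _ _ _ (nbhs y) (nbhs_filter y) _ _ h e e0.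
apply: filterS => z.
rewrite {1}/enorm {1}/edot big1 ?sqrtr0 => [|l _]; last by rewrite mxE mul0r.
rewrite sub0r normrN ger0_norm ?enorm_ge0//; apply: le_trans.
apply: le_trans (is_proj_nonexpansive vS (eprojP y cS S0) (eprojP z cS S0)).
by apply: le_trans (enorm_coord _ i); rewrite !mxE.
Qed.

End EuclideanTheory.

(** * Measurability of vector-valued maps through their coordinates *)

Section MeasurableRowVectors.
Context {R : realType} {d : nat} {dd : measure_display} {Omega : measurableType dd}.
Implicit Types (X : Omega -> 'rV[R]_d).

(* Open sets of R^d are countable unions of boxes with rational vertices. *)
Lemma measurable_preimage_open X (O : set 'rV[R]_d) :
  (forall i, measurable_fun setT (fun w => X w 0 i)) -> open O ->
  measurable (X @^-1` O).
Proof.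
move=> mX oO.
pose box (q : {ffun 'I_d -> rat * rat}) :=
  [set y : 'rV[R]_d | forall i, ratr (q i).1 < y 0 i < ratr (q i).2].
(* The union runs over all rational boxes, a countable index type; those not contained in [O]
   contribute the empty set. *)
have -> : X @^-1` O =
    \bigcup_(q : {ffun 'I_d -> rat * rat})
      (if `[< box q `<=` O >] then X @^-1` box q else set0).
  apply/seteqP; split => [w /= Ow|w /= [q _]]; last by case: asboolP => // + bq; exact.
  have [P Pn PO] : nbhs (X w) O by apply: open_nbhs_nbhs; split.
  have [q qP] : {q : 'I_d -> rat * rat & forall i,
      ratr (q i).1 < X w 0 i < ratr (q i).2 /\
      forall y : R, ratr (q i).1 < y < ratr (q i).2 -> P 0 i y}.
    apply: (@choice _ _ (fun i q => ratr q.1 < X w 0 i < ratr q.2 /\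
      forall y : R, ratr q.1 < y < ratr q.2 -> P 0 i y)) => i.
    have /nbhs_ballP[e e0 Pe] := Pn 0 i.
    have [|a /itvP aP] := @rat_in_itvoo R (X w 0 i - e) (X w 0 i).
      by rewrite ltrBlDr ltrDl.
    have [|b /itvP bP] := @rat_in_itvoo R (X w 0 i) (X w 0 i + e).
      by rewrite ltrDl.
    exists (a, b); split => [|y /andP[ay yb]] /=; first by rewrite aP bP.
    apply: Pe; rewrite /ball/= ltr_distlC (lt_trans _ ay) ?aP//=.
    by rewrite (lt_trans yb) ?bP.
  exists [ffun i => q i] => //; case: asboolP => [_ i|].
    by rewrite ffunE; have [] := qP i.
  case=> y yq; apply: PO => i j; rewrite ord1; apply: (qP j).2.
  by have := yq j; rewrite ffunE.
apply: countable_bigcupT_measurable => [|q]; first exact: countableP.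
case: asboolP => // _.
have -> : X @^-1` box q = \bigcap_(i : 'I_d)
    (setT `&` (fun w => X w 0 i) @^-1` `]ratr (q i).1, ratr (q i).2[).
  apply/seteqP; split => [w Xq i _|w Xq i]; last first.
    by have [_] := Xq i Logic.I; rewrite /= in_itv.
  by split => //=; rewrite in_itv; exact: Xq.
by apply: fin_bigcap_measurable => // i _; exact: mX.
Qed.

Lemma measurable_fun_continuous_coords X (F : 'rV[R]_d -> R) : continuous F ->
  (forall i, measurable_fun setT (fun w => X w 0 i)) ->
  measurable_fun setT (fun w => F (X w)).
Proof.
move=> /continuousP cF mX; apply: (measurability _ (RGenOpens.measurableE R)).
move=> _ [_ [a [b ->] <-]]; rewrite setTI.
apply: (measurable_preimage_open mX (O := F @^-1` `]a, b[)).
by apply: cF; exact: interval_open.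
Qed.

End MeasurableRowVectors.

(** * Measurability of the estimator and of the iterates *)

Section MeasurableIterates.
Context {R : realType} {d : nat} {dd : measure_display} {Omega : measurableType dd}.
Variables (g : 'rV[R]_d -> R) (Kk K1 : R -> R) (k : nat) (j : 'I_d).
Hypotheses (cg : continuous g) (mKk : measurable_fun setT Kk)
  (mK1 : measurable_fun setT K1).

Lemma measurable_grad_est (h : R) (X : Omega -> 'rV[R]_d)
    (u v ep em : 'I_d -> Omega -> R) :
  (forall i, measurable_fun setT (fun w => X w 0 i)) ->
  (forall i, measurable_fun setT (u i)) -> (forall i, measurable_fun setT (v i)) ->
  (forall i, measurable_fun setT (ep i)) -> (forall i, measurable_fun setT (em i)) ->
  forall i, measurable_fun setT (fun w => grad_est g Kk K1 k j h (X w)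
    (u ^~ w) (v ^~ w) (ep ^~ w) (em ^~ w) 0 i).
Proof.
move=> mX mu mv mp mm i.
rewrite (_ : (fun w => _) = fun w => Kk (u i w) * K1 (v i w) / (2 * h ^+ k.+1) *
    ((g (X w + (h * u i w) *: evec j + (h * v i w) *: evec i) + ep i w) -
     (g (X w + (h * u i w) *: evec j - (h * v i w) *: evec i) + em i w)));
  last by apply/funext => w; rewrite mxE.
apply: measurable_funM.
  apply: measurable_funM; last exact: measurable_cst.
  by apply: measurable_funM; apply: measurableT_comp.
have mhu : measurable_fun setT (fun w => h * u i w).
  by apply: measurable_funM => //; exact: measurable_cst.
have mhv : measurable_fun setT (fun w => h * v i w).
  by apply: measurable_funM => //; exact: measurable_cst.
apply: measurable_funB; apply: measurable_funD => //;
  apply: measurable_fun_continuous_coords => // l.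
- rewrite (_ : (fun w => _) = fun w => X w 0 l + (h * u i w) * evec j 0 l +
    (h * v i w) * evec i 0 l); last by apply/funext => w; rewrite !mxE.
  apply: measurable_funD; first apply: measurable_funD => //;
  by apply: measurable_funM => //; exact: measurable_cst.
- rewrite (_ : (fun w => _) = fun w => X w 0 l + (h * u i w) * evec j 0 l -
    (h * v i w) * evec i 0 l); last by apply/funext => w; rewrite !mxE.
  apply: measurable_funB; first apply: measurable_funD => //;
  by apply: measurable_funM => //; exact: measurable_cst.
Qed.

(* Omega is only required to make the variables drawn before step s measurable:
   the lemma is used with the given sigma-algebra and with smaller ones. *)
Lemma measurable_iterates (S : set 'rV[R]_d) (T : nat)
    (U V ep em : 'I_T -> 'I_d -> Omega -> R) (eta h : nat -> R) x0
    (x : nat -> Omega -> 'rV[R]_d) (s : nat) :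
  compact S -> convex_set S -> S !=set0 ->
  (forall w, x 0%N w = x0) ->
  (forall (r : 'I_T) w, is_proj S (x r w - eta r *: grad_est g Kk K1 k j (h r)
     (x r w) (U r ^~ w) (V r ^~ w) (ep r ^~ w) (em r ^~ w)) (x r.+1 w)) ->
  (forall (r : 'I_T) l, (r < s)%N -> [/\ measurable_fun setT (U r l),
     measurable_fun setT (V r l), measurable_fun setT (ep r l) &
     measurable_fun setT (em r l)]) ->
  (s <= T)%N ->
  forall i, measurable_fun setT (fun w => x s w 0 i).
Proof.
move=> cS vS S0 hx0 hx; elim: s => [|s IH] ms sT i.
  rewrite (_ : (fun w => _) = cst (x0 0 i)); first exact: measurable_cst.
  by apply/funext => w; rewrite hx0.
pose r := Ordinal sT; have {}IH := IH (fun q l qs => ms q l (ltnW qs)) (ltnW sT).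
(* The recursion specifies the new iterate only by [is_proj]; uniqueness turns it into [eproj] of
   the descent step, a continuous function of measurable coordinates. *)
rewrite (_ : (fun w => _) = fun w => eproj S (x r w - eta r *: grad_est g Kk K1 k j
    (h r) (x r w) (U r ^~ w) (V r ^~ w) (ep r ^~ w) (em r ^~ w)) 0 i); last first.
  by apply/funext => w; rewrite -(eproj_unique vS (hx r w)).
apply: (@measurable_fun_continuous_coords _ _ _ _ (fun w => x r w - eta r *:
    grad_est g Kk K1 k j (h r) (x r w) (U r ^~ w) (V r ^~ w) (ep r ^~ w) (em r ^~ w))
  _ (continuous_eproj cS vS S0)) => l.
rewrite (_ : (fun w => _) = fun w => x r w 0 l - eta r * grad_est g Kk K1 k j (h r)
    (x r w) (U r ^~ w) (V r ^~ w) (ep r ^~ w) (em r ^~ w) 0 l); last first.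
  by apply/funext => w; rewrite !mxE.
apply: measurable_funB; first exact: IH.
apply: measurable_funM; first exact: measurable_cst.
by apply: measurable_grad_est => // q; have [] := ms r q (leqnn _).
Qed.

End MeasurableIterates.

(** * Expectation of a product of independent nonnegative variables *)

Section ExpectationProduct.
Context {R : realType} {dd : measure_display} {Omega : measurableType dd}.
Variable P : probability Omega R.
Local Open Scope ereal_scope.

(** Independence says that the law of the pair agrees with the product of the marginal laws on
    rectangles, hence everywhere; Tonelli then splits the integral. *)
Lemma ge0_expectation_indepM (X Y : Omega -> R) :
  measurable_fun setT X -> measurable_fun setT Y ->
  (forall w, 0 <= X w)%R -> (forall w, 0 <= Y w)%R ->
  (forall A B, measurable A -> measurable B ->
     P (X @^-1` A `&` Y @^-1` B) = P (X @^-1` A) * P (Y @^-1` B)) ->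
  \int[P]_w (X w * Y w)%:E = \int[P]_w (X w)%:E * \int[P]_w (Y w)%:E.
Proof.
move=> mX mY X0 Y0 indXY.
pose X' : {RV P >-> R} := HB.pack X (isMeasurableFun.Build _ _ _ _ X mX).
pose Y' : {RV P >-> R} := HB.pack Y (isMeasurableFun.Build _ _ _ _ Y mY).
pose Z w := (X w, Y w).
have mZ : measurable_fun setT Z by exact: measurable_fun_pair.
pose Z' : {RV P >-> (R * R)%type} := HB.pack Z (isMeasurableFun.Build _ _ _ _ Z mZ).
pose m1 := distribution P X'; pose m2 := distribution P Y'.
(* The absolute values make the integrand nonnegative on the whole plane and change nothing on the
   range of the pair. *)
pose f (z : R * R) := (`|z.1| * `|z.2|)%:E.
have mf : measurable_fun setT f.
  by apply/measurable_EFinP; apply: measurable_funM; apply: measurableT_comp.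
have f0 z : 0 <= f z by rewrite lee_fin mulr_ge0.
have mabs : measurable_fun setT (fun y : R => `|y|%:E).
  by apply/measurable_EFinP; exact: normr_measurable.
transitivity (\int[distribution P Z']_z f z).
  rewrite ge0_integral_distribution//; apply: eq_integral => w _.
  by rewrite /f/= !ger0_norm.
transitivity (\int[m1 \x m2]_z f z).
  apply: eq_measure_integral => A mA _; apply/esym.
  apply: product_measure_unique => // B C mB mC; exact: indXY.
rewrite fubini_tonelli1//.
transitivity (\int[m1]_x (`|x|%:E * \int[m2]_y `|y|%:E)).
  apply: eq_integral => x _; rewrite -ge0_integralZl//.
rewrite ge0_integralZr//; last exact: integral_ge0.
rewrite !ge0_integral_distribution//.
by congr (_ * _); apply: eq_integral => w _ /=; rewrite ger0_norm.
Qed.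

End ExpectationProduct.

(** * Independence of one draw from all other draws and the noise *)

Section LeaveOneOut.
Context {R : realType} {dd : measure_display} {Omega : measurableType dd}.
Variable P : probability Omega R.
Variables (I : finType) (I' : Type) (W : I -> Omega -> R) (N : I' -> Omega -> R).
Hypotheses (mW : forall i, measurable_fun setT (W i))
  (mN : forall i, measurable_fun setT (N i))
  (iW : mutually_independent P W) (iWN : independent_families P W N).

Lemma gen_sigma_measurable (K : Type) (X : K -> Omega -> R) A :
  (forall i, measurable_fun setT (X i)) -> gen_sigma X A -> measurable A.
Proof.
move=> mX; apply: smallest_sub; first exact: sigma_algebra_measurable.
by move=> _ [i _ [B mB <-]]; exact: mX.
Qed.

Lemma gen_sigma_preimage (K : Type) (X : K -> Omega -> R) i B :
  measurable B -> gen_sigma X (X i @^-1` B).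
Proof.
by move=> mB; apply: sub_gen_smallest; exists i => //; exists B; rewrite ?setTI.
Qed.

(* A pi-system generating the sigma-algebra of all the W i with i != i0 and of
   the whole family N. *)
Definition others (i0 : I) : set (set Omega) :=
  [set A | exists B E, [/\ forall i, measurable (B i), B i0 = setT,
     gen_sigma N E & A = (\bigcap_(i in [set` [set: I]%SET]) W i @^-1` B i) `&` E]].

Lemma gen_sigma_bigcap (J : {set I}) (B : I -> set R) :
  (forall i, measurable (B i)) ->
  gen_sigma W (\bigcap_(i in [set` J]) W i @^-1` B i).
Proof.
move=> mB.
have := @fin_bigcap_measurable _ (g_sigma_algebraType
  (\bigcup_i preimage_set_system setT (W i) measurable)).
apply => // i _; exact: gen_sigma_preimage.
Qed.

Lemma others_measurable i0 : others i0 `<=` measurable.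
Proof.
move=> _ [B [E [mB _ NE ->]]]; apply: measurableI.
  by apply: gen_sigma_measurable mW _; exact: gen_sigma_bigcap.
exact: gen_sigma_measurable mN NE.
Qed.

Lemma others_setI i0 : setI_closed (others i0).
Proof.
move=> _ _ [B [E [mB B0 NE ->]]] [B' [E' [mB' B'0 NE' ->]]].
exists (fun i => B i `&` B' i), (E `&` E'); split.
- by move=> i; exact: measurableI.
- by rewrite B0 B'0 setTI.
- exact: (@measurableI _ (g_sigma_algebraType
    (\bigcup_i preimage_set_system setT (N i) measurable))).
- rewrite setIACA; congr (_ `&` _); apply/seteqP; split => [w [a b] i Ji|w a].
    by split; [exact: a|exact: b].
  by split => i Ji; have [] := a i Ji.
Qed.

Lemma others_setT i0 : others i0 setT.
Proof.
exists (fun=> setT), setT; split => //.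
- exact: (@measurableT _ (g_sigma_algebraType
    (\bigcup_i preimage_set_system setT (N i) measurable))).
- by rewrite setIT; apply/seteqP; split.
Qed.

Lemma indep_others_gen i0 B M : measurable B -> others i0 M ->
  P (W i0 @^-1` B `&` M) = (P (W i0 @^-1` B) * P M)%E.
Proof.
move=> mB [C [E [mC C0 NE ->]]].
pose D i := if i == i0 then B else C i.
have mD i : measurable (D i) by rewrite /D; case: ifP.
have -> : W i0 @^-1` B `&` (\bigcap_(i in [set` [set: I]%SET]) W i @^-1` C i `&` E) =
    \bigcap_(i in [set` [set: I]%SET]) W i @^-1` D i `&` E.
  rewrite setIA; congr (_ `&` _); apply/seteqP; split => [w [a b] i Ji|w a].
    by rewrite /D; case: eqP => [->//|_]; exact: b.
  split; first by have := a i0 (finset.in_setT _); rewrite /D/= eqxx.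
  move=> i Ji; have := a i Ji; rewrite /D/=; case: eqP => // ->; by rewrite C0.
rewrite !iWN//; [|exact: gen_sigma_bigcap..].
rewrite !iW// muleA; congr (_ * _)%E.
rewrite (bigD1 i0) ?finset.in_setT//= [in RHS](bigD1 i0) ?finset.in_setT//= /D eqxx C0.
rewrite preimage_setT probability_setT mul1e; congr (_ * _)%E.
by apply: eq_bigr => i /andP[_ /negbTE ->].
Qed.

Lemma indep_others i0 B M : measurable B -> <<s others i0 >> M ->
  P (W i0 @^-1` B `&` M) = (P (W i0 @^-1` B) * P M)%E.
Proof.
move=> mB; have mWB : measurable (W i0 @^-1` B).
  by rewrite -[X in measurable X]setTI; exact: mW.
pose m1 := mrestr P mWB.
have p0 : 0 <= fine (P (W i0 @^-1` B)) by exact: fine_ge0.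
pose m2 := mscale (NngNum p0) P.
have E M' : m2 M' = (P (W i0 @^-1` B) * P M')%E.
  by rewrite /m2/= /mscale/= fineK ?fin_num_measure.
move=> sM; rewrite -E setIC.
apply: (@g_sigma_algebra_measure_unique _ _ _ (others i0) _ (fun=> setT) _ _ m1 m2) => //.
- exact: others_measurable.
- by move=> _; exact: others_setT.
- by apply/seteqP; split => // w _; exists 0%N.
- exact: others_setI.
- move=> A oA; apply: etrans (esym (E A)).
  by rewrite -(indep_others_gen mB oA) setIC.
- move=> _; apply: le_lt_trans (ltry 1); apply: probability_le1.
  exact: measurableI.
Qed.

Lemma measurable_others_coord i0 i : i != i0 ->
  measurable_fun setT (W i : g_sigma_algebraType (others i0) -> R).
Proof.
move=> ii0 _ B mB; rewrite setTI; apply: sub_gen_smallest.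
exists (fun l => if l == i then B else setT), setT; split.
- by move=> l; case: ifP.
- by rewrite eq_sym (negbTE ii0).
- exact: (@measurableT _ (g_sigma_algebraType
    (\bigcup_i preimage_set_system setT (N i) measurable))).
- rewrite setIT; apply/seteqP; split => [w Ww l _/=|w /(_ i (finset.in_setT _))/=].
    by case: eqP => // ->.
  by rewrite eqxx.
Qed.

Lemma measurable_others_noise i0 i :
  measurable_fun setT (N i : g_sigma_algebraType (others i0) -> R).
Proof.
move=> _ B mB; rewrite setTI; apply: sub_gen_smallest.
exists (fun=> setT), (N i @^-1` B); split => //; first exact: gen_sigma_preimage.
by apply/seteqP; split => [w Ww|w []//]; split.
Qed.

Lemma measurable_fun_others i0 (Y : Omega -> R) :
  measurable_fun setT (Y : g_sigma_algebraType (others i0) -> R) ->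
  measurable_fun setT Y.
Proof.
move=> mY _ B mB; have := mY measurableT B mB.
by apply: smallest_sub; [exact: sigma_algebra_measurable|exact: others_measurable].
Qed.

Lemma expectation_others i0 (f : R -> R) (Y : Omega -> R) :
  measurable_fun setT f -> (forall r, 0 <= f r) ->
  measurable_fun setT (Y : g_sigma_algebraType (others i0) -> R) ->
  (forall w, 0 <= Y w) ->
  (\int[P]_w (f (W i0 w) * Y w)%:E =
   \int[P]_w (f (W i0 w))%:E * \int[P]_w (Y w)%:E)%E.
Proof.
move=> mf f0 mY Y0; apply: (@ge0_expectation_indepM _ _ _ P (f \o W i0)) => //.
- exact: measurableT_comp.
- exact: measurable_fun_others mY.
- by move=> w; exact: f0.
- move=> A B mA mB; rewrite comp_preimage; apply: indep_others.
    by rewrite -[X in measurable X]setTI; exact: mf.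
  by have := mY measurableT B mB; rewrite setTI.
Qed.

End LeaveOneOut.

Section ConditionalExpectation.
Context {R : realType} {dd : measure_display} {Omega : measurableType dd}.
Variable P : probability Omega R.
Variables (I : Type) (X : I -> Omega -> R).
Hypothesis mX : forall i, measurable_fun setT (X i).

Lemma cond_exp_le_integral (Y : Omega -> R) (c : R) A : (forall w, 0 <= Y w) ->
  cond_exp_le P X Y c -> gen_sigma X A ->
  (\int[P]_(w in A) (Y w)%:E <= c%:E * P A)%E.
Proof.
move=> Y0 [Z [iY iZ mZ YZ] Zc] sA.
have mA : measurable A by exact: gen_sigma_measurable mX sA.
rewrite -YZ// -integral_cst//.
have iA f : P.-integrable setT f -> P.-integrable A f by exact: integrableS.
have ic : P.-integrable A (cst c%:E) by exact: finite_measure_integrable_cst.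
case: Zc => M [mM PM ZcM].
rewrite (negligible_integral mM mA (iA _ iZ) PM) (negligible_integral mM mA ic PM).
have iD f : P.-integrable A f -> P.-integrable (A `\` M) f.
  by apply: integrableS => //; exact: measurableD.
apply: le_integral; [exact: measurableD|exact/iD/iA|exact: iD|].
move=> w; rewrite inE => -[_ Mw]; rewrite lee_fin; apply: contrapT => Zw.
by apply: Mw; exact: ZcM.
Qed.

Lemma cond_exp_exists (Y : Omega -> R) :
  P.-integrable setT (EFin \o Y) -> exists Z, is_cond_exp P X Y Z.
Proof.
move=> iY.
pose Om := g_sigma_algebraType (\bigcup_i preimage_set_system setT (X i) measurable).
pose emb : Omega -> Om := id.
have memb : measurable_fun setT emb.
  by move=> _ B mB; rewrite setTI; exact: gen_sigma_measurable mX mB.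
pose emb' : {RV P >-> Om} := HB.pack emb (isMeasurableFun.Build _ _ _ _ emb memb).
pose mu := distribution P emb'.
pose nu := pushforward (induced_charge iY) emb'.
have dom : nu `<< mu.
  apply: dominates_pushforward => //; apply/null_content_dominatesP => A mA A0.
  apply: null_set_integral => //.
  by apply: measurable_funTS; exact: measurable_int iY.
have [f [f_fin f_int f_nu]] : exists f : Om -> \bar R,
    [/\ forall w, f w \is a fin_num, mu.-integrable setT f &
        forall A, measurable A -> nu A = (\int[mu]_(w in A) f w)%E].
  pose f := Radon_Nikodym nu mu; exists (f memb).
  by split=> [w||A mA]; [exact: Radon_Nikodym_fin_num|
    exact: Radon_Nikodym_integrable|exact: Radon_Nikodym_integral].
have mf := measurable_int _ f_int.
have fE : EFin \o (fine \o f) = f by apply/funext => w /=; rewrite fineK.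
have f_intP : P.-integrable setT f.
  apply/integrableP; split.
    by have := measurableT_comp mf memb.
  move/integrableP : f_int => [_]; rewrite ge0_integral_distribution//.
  exact: measurableT_comp.
exists (fine \o f); split => //.
- by rewrite fE.
- move=> B mB; have mff : measurable_fun setT (fine \o f) by exact: measurableT_comp.
  by have := mff measurableT B mB; rewrite setTI.
- move=> A sA; have <- : nu A = (\int[P]_(w in A) (Y w)%:E)%E by [].
  rewrite f_nu// integral_pushforward//; last first.
    by apply: integrableS f_intP => //; exact: gen_sigma_measurable mX sA.
  by apply: eq_integral => w _; rewrite /= fineK.
Qed.

Lemma cond_exp_leP (Y : Omega -> R) (c : R) :
  measurable_fun setT Y -> (forall w, 0 <= Y w) ->
  (forall A, gen_sigma X A -> \int[P]_(w in A) (Y w)%:E <= c%:E * P A)%E ->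
  cond_exp_le P X Y c.
Proof.
move=> mY Y0 Yc.
have iY : P.-integrable setT (EFin \o Y).
  apply/integrableP; split; first exact/measurable_EFinP.
  under eq_integral do rewrite /= ger0_norm//.
  apply: le_lt_trans (Yc setT _) _.
    exact: (@measurableT _ (g_sigma_algebraType
      (\bigcup_i preimage_set_system setT (X i) measurable))).
  by rewrite probability_setT mule1 ltry.
have [Z ZP] := cond_exp_exists iY; exists Z => //.
case: ZP => _ iZ mZ YZ.
pose A := Z @^-1` [set r | c < r].
have sA : gen_sigma X A.
  apply: mZ; rewrite (_ : [set r | _] = `]c, +oo[%classic) //.
  by apply/seteqP; split => r /=; rewrite in_itv/= andbT.
have mA : measurable A by exact: gen_sigma_measurable mX sA.
have iZA : P.-integrable A (EFin \o Z) by exact: integrableS iZ.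
have icA : P.-integrable A (cst c%:E) by exact: finite_measure_integrable_cst.
have : (\int[P]_(w in A) `|((EFin \o Z) \- cst c%:E) w| = 0)%E.
  apply/eqP; rewrite eq_le integral_ge0// andbT.
  rewrite (eq_integral ((EFin \o Z) \- cst c%:E)%E); last first.
    by move=> w; rewrite inE /A/= => cZ; rewrite ger0_norm// subr_ge0 ltW.
  rewrite integralB// integral_cst// YZ// sube_le0//.
  exact: Yc.
move/ae_eq_integral_abs => /(_ mA).
have mZc : measurable_fun A ((EFin \o Z) \- cst c%:E)%E.
  by apply: measurable_int; exact: integrableB icA.
move=> /(_ mZc); apply: filterS => w h; rewrite leNgt; apply/negP => cZ.
have /= := h cZ; move=> [] /eqP; rewrite subr_eq0 => /eqP E.
by rewrite E ltxx in cZ.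
Qed.

End ConditionalExpectation.

Section FiniteDifference.
Context {R : realType} {d : nat}.
Implicit Types (g : 'rV[R]_d -> R) (p : 'rV[R]_d).

Lemma is_derive_line g p (l : 'I_d) (s : R) : differentiable g (p + s *: evec l) ->
  is_derive s 1 (fun r => g (p + r *: evec l)) (partial l g (p + s *: evec l)).
Proof.
move=> /(@diff_derivable _ _ _ _ _ (evec l)).
rewrite /partial /derivable /derive.
set q := p + s *: evec l; set F := (fun r => g (p + r *: evec l)).
have E : (fun h : R => h^-1 *: ((g \o shift q) (h *: evec l) - g q)) =
         (fun h : R => h^-1 *: ((F \o shift s) (h *: 1) - F s)).
  apply/funext => h; congr (_ *: (_ - _)); rewrite /F/=; congr g.
  by rewrite /q [h *: 1]mulr1 scalerDl addrCA.
by rewrite E => D; apply: DeriveDef.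
Qed.

Lemma central_difference_bound g p (l : 'I_d) (b C : R) :
  (forall z, differentiable g z) ->
  (forall s, `|s| <= `|b| -> `|partial l g (p + s *: evec l)| <= C) ->
  `|g (p + b *: evec l) - g (p - b *: evec l)| <= 2 * `|b| * C.
Proof.
move=> dg; wlog b0 : b / 0 <= b => [H|].
  have [/H//|b0 gC] := leP 0 b.
  have := H (- b); rewrite normrN oppr_ge0 scaleNr opprK distrC.
  by apply => //; exact: ltW.
rewrite ger0_norm// => gC.
pose F (r : R) := g (p + r *: evec l).
have dF (s : R) : is_derive s 1 F (partial l g (p + s *: evec l)) by exact: is_derive_line.
have cF : {within `[- b, b], continuous F}.
  apply: continuous_subspaceT => s.
  by apply/differentiable_continuous/derivable1_diffP; case: (dF s).
have Nb : - b <= b by rewrite (le_trans _ b0)// oppr_le0.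
have [c cb] := MVT_segment Nb (fun s _ => dF s) cF.
rewrite /F scaleNr opprK => ->; rewrite normrM (ger0_norm (addr_ge0 b0 b0)).
have -> : 2 * b * C = C * (b + b) by ring.
rewrite ler_wpM2r ?addr_ge0// gC//.
by rewrite ler_norml; move: cb; rewrite in_itv.
Qed.

End FiniteDifference.

Section EstimatorBound.
Context {R : realType} {d : nat}.
Variables (g : 'rV[R]_d -> R) (Kk K1 : R -> R) (k : nat) (j : 'I_d).
Variables (S : set 'rV[R]_d) (Gg h : R).
Hypotheses (dg : forall z, differentiable g z)
  (gradg : forall z, enlarge S z -> enorm (grad g z) <= Gg) (Gg0 : 0 <= Gg)
  (h0 : 0 < h) (h1 : h <= 1) (kKk : kernel_on Kk) (kK1 : kernel_on K1).

Lemma enorm_two_coords (l : 'I_d) (a b : R) : `|a| <= 2^-1 -> `|b| <= 2^-1 ->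
  enorm (a *: evec j + b *: evec l) <= 1.
Proof.
move=> ha hb; rewrite -(@sqrtr1 R) ler_sqrt//.
rewrite edotDl !edotDr !edotZl !edotZr !edot_evec !eqxx (eq_sym l).
have [] := (ler_normlP _ _ ha, ler_normlP _ _ hb) => -[a1 a2] [b1 b2].
by case: (j == l) => /=; nra.
Qed.

Lemma oracle_difference_bound x (l : 'I_d) u v : S x ->
  `|u| <= 2^-1 -> `|v| <= 2^-1 ->
  `|g (x + (h * u) *: evec j + (h * v) *: evec l) -
    g (x + (h * u) *: evec j - (h * v) *: evec l)| <= Gg.
Proof.
move=> Sx hu hv.
have hle (r : R) : `|r| <= 2^-1 -> `|h * r| <= 2^-1.
  by move=> hr; rewrite normrM gtr0_norm// (le_trans _ hr)// ler_piMl.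
apply: (le_trans (central_difference_bound (C := Gg) dg _)) => [s sh|].
  have ES : enlarge S (x + (h * u) *: evec j + s *: evec l).
    rewrite -addrA; apply: enlarge_shift => //; apply: enorm_two_coords.
      exact: hle.
    by rewrite (le_trans sh)// hle.
  apply: le_trans (gradg ES); apply: le_trans (enorm_coord _ l).
  by rewrite mxE.
by rewrite ler_piMl// mulrC -ler_pdivlMr// mul1r hle.
Qed.

Lemma sqr_grad_est_le x (l : 'I_d) (u v ep em : 'I_d -> R) : S x ->
  grad_est g Kk K1 k j h x u v ep em 0 l ^+ 2 <=
  (2 * h ^+ k.+1) ^- 2 * (Kk (u l) ^+ 2 * (K1 (v l) ^+ 2 *
    (2 * Gg ^+ 2 + 4 * ep l ^+ 2 + 4 * em l ^+ 2))).
Proof.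
move=> Sx; rewrite mxE.
set D1 := g _; set D2 := g _; set c := 2 * h ^+ _.
have rhs0 : 0 <= c ^- 2 * (Kk (u l) ^+ 2 * (K1 (v l) ^+ 2 *
    (2 * Gg ^+ 2 + 4 * ep l ^+ 2 + 4 * em l ^+ 2))).
  have E0 : 0 <= 2 * Gg ^+ 2 + 4 * ep l ^+ 2 + 4 * em l ^+ 2.
    by rewrite !addr_ge0// mulr_ge0 ?sqr_ge0.
  by rewrite mulr_ge0 ?invr_ge0 ?sqr_ge0// mulr_ge0 ?sqr_ge0// mulr_ge0 ?sqr_ge0.
have [hu|/negP/negP hu] := boolP (u l \in `[- 2^-1, 2^-1]); last first.
  have [_ /(_ _ hu) K0 _] := kKk.
  by apply: le_trans rhs0; rewrite K0 !mul0r expr0n.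
have [hv|/negP/negP hv] := boolP (v l \in `[- 2^-1, 2^-1]); last first.
  have [_ /(_ _ hv) K0 _] := kK1.
  by apply: le_trans rhs0; rewrite K0 mulr0 !mul0r expr0n.
have D : `|D1 - D2| <= Gg.
  by apply: oracle_difference_bound => //; rewrite ler_norml;
    [move: hu|move: hv]; rewrite in_itv.
have -> : (Kk (u l) * K1 (v l) / c * (D1 + ep l - (D2 + em l))) ^+ 2 =
    c ^- 2 * (Kk (u l) ^+ 2 * (K1 (v l) ^+ 2 * (D1 + ep l - (D2 + em l)) ^+ 2)).
  by rewrite -exprVn; move: c^-1 => i; ring.
rewrite ler_wpM2l ?invr_ge0 ?sqr_ge0// !ler_wpM2l ?sqr_ge0//.
have D2le : (D1 - D2) ^+ 2 <= Gg ^+ 2.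
  by rewrite -(real_normK (num_real _)) ler_pXn2r ?nnegrE.
have := sqr_ge0 (D1 - D2 - (ep l - em l)); have := sqr_ge0 (ep l + em l).
move: D2le; nra.
Qed.

End EstimatorBound.

Section KernelSecondMoment.
Context {R : realType}.
Implicit Types K : R -> R.

Lemma ksqmean_ge0 K : 0 <= ksqmean K.
Proof. by apply: fine_ge0; apply: expectation_ge0 => u; exact: sqr_ge0. Qed.

Lemma ksqmeanE K : kernel_on K ->
  (\int[unif]_u (K u ^+ 2)%:E = (ksqmean K)%:E)%E.
Proof.
move=> [mK _ [M KM]].
have mK2 : measurable_fun setT (fun u => (K u ^+ 2)%:E).
  by apply/measurable_EFinP; exact: measurable_funX.
rewrite /ksqmean fineK unlock// ge0_fin_numE; last first.
  by apply: integral_ge0 => u _; rewrite lee_fin sqr_ge0.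
apply: (@le_lt_trans _ _ (\int[unif]_u (M ^+ 2)%:E)%E).
  apply: ge0_le_integral => //= [u _|u _].
  - by rewrite lee_fin sqr_ge0.
  - by rewrite lee_fin -(real_normK (num_real _)) lerXn2r ?nnegrE// (le_trans _ (KM u)).
by rewrite integral_cst// [X in (_ * X)%E](@probability_setT _ _ _ unif) mule1 ltry.
Qed.

Lemma expectation_uniform_kernel (dd : measure_display) (Omega : measurableType dd)
    (P : probability Omega R) (X : {RV P >-> R}) K : uniform_law P X -> kernel_on K ->
  (\int[P]_w (K (X w) ^+ 2)%:E = (ksqmean K)%:E)%E.
Proof.
move=> uX kK; rewrite -ksqmeanE//.
have [mK _ _] := kK.
have mK2 : measurable_fun setT (fun u => (K u ^+ 2)%:E).
  by apply/measurable_EFinP; exact: measurable_funX.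
have mX : measurable_fun setT (X : Omega -> measurableTypeR R).
  exact: (@measurable_funPT _ _ _ _ X).
pose X' : {RV P >-> measurableTypeR R} :=
  HB.pack (X : Omega -> measurableTypeR R) (isMeasurableFun.Build _ _ _ _ _ mX).
transitivity (\int[distribution P X']_u (K u ^+ 2)%:E)%E.
  by rewrite ge0_integral_distribution// => u; rewrite lee_fin sqr_ge0.
by apply: eq_measure_integral => A mA _; exact: uX.
Qed.

End KernelSecondMoment.

Section EstimatorSecondMoment.
Context {R : realType} {d : nat} {dd : measure_display} {Omega : measurableType dd}.
Variables (P : probability Omega R) (T : nat).
Variables (U V ep em : 'I_T -> 'I_d -> {RV P >-> R}).
Variables (g : 'rV[R]_d -> R) (Kk K1 : R -> R) (k : nat) (j : 'I_d).
Variables (S : set 'rV[R]_d) (Gg h sigma : R) (t : 'I_T).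
Hypotheses (dg : forall z, differentiable g z)
  (gradg : forall z, enlarge S z -> enorm (grad g z) <= Gg) (Gg0 : 0 <= Gg)
  (h0 : 0 < h) (h1 : h <= 1) (kKk : kernel_on Kk) (kK1 : kernel_on K1)
  (oracle : oracle_model sigma U V ep em).

Let W := merge_families U V.
Let N := merge_families ep em.

Lemma measurable_step_est (X : Omega -> 'rV[R]_d) :
  (forall i, measurable_fun setT (fun w => X w 0 i)) ->
  forall i, measurable_fun setT
    (fun w => step_est g Kk K1 k j U V ep em t h (X w) w 0 i).
Proof.
move=> mX i; have [mKk _ _] := kKk; have [mK1 _ _] := kK1.
apply: (@measurable_grad_est R d dd Omega g Kk K1 k j _ mKk mK1 h X (U t) (V t)
  (ep t) (em t)) => // z.
exact: differentiable_continuous.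
Qed.

Lemma measurable_merge (A B : 'I_T -> 'I_d -> {RV P >-> R}) i :
  measurable_fun setT (merge_families A B i).
Proof. by rewrite /merge_families; case: ifP. Qed.

Lemma expectation_kernels (l : 'I_d) (Y : Omega -> R) : (forall w, 0 <= Y w) ->
  (forall b, measurable_fun setT (Y : g_sigma_algebraType (others W N (t, l, b)) -> R)) ->
  (\int[P]_w (Kk (U t l w) ^+ 2 * (K1 (V t l w) ^+ 2 * Y w))%:E =
   (ksqmean Kk * ksqmean K1)%:E * \int[P]_w (Y w)%:E)%E.
Proof.
move=> Y0 mY; have [mKk _ _] := kKk; have [mK1 _ _] := kK1.
have [iW uU uV _ _ iWN] := oracle.
have mW := measurable_merge U V; have mN := measurable_merge ep em.
have sq (K : R -> R) : measurable_fun setT K -> measurable_fun setT (fun u => K u ^+ 2).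
  exact: measurable_funX.
have := expectation_others mW mN iW iWN (i0 := (t, l, true)) (f := fun u => Kk u ^+ 2)
  (Y := fun w => K1 (V t l w) ^+ 2 * Y w).
rewrite /= => ->//.
- have := expectation_others mW mN iW iWN (i0 := (t, l, false)) (f := fun u => K1 u ^+ 2)
    (Y := Y).
  rewrite /= => ->//; last by move=> r; exact: sqr_ge0.
    rewrite (expectation_uniform_kernel (uU t l) kKk).
    by rewrite (expectation_uniform_kernel (uV t l) kK1) muleA EFinM.
  exact: sq.
- exact: sq.
- by move=> r; exact: sqr_ge0.
- apply: measurable_funM => //.
  apply: (measurableT_comp (sq _ mK1)).
  apply: (@measurable_others_coord _ _ _ _ _ W N (t, l, true) (t, l, false)).
  by rewrite xpair_eqE andbF.
- by move=> w; rewrite mulr_ge0 ?sqr_ge0.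
Qed.

Lemma integral_sqr_estimator_le (X : Omega -> 'rV[R]_d) (A : set Omega) :
  (forall w, S (X w)) -> (forall i, measurable_fun setT (fun w => X w 0 i)) ->
  measurable A -> (forall l b, <<s others W N (t, l, b) >> A) ->
  (forall l, (\int[P]_(w in A) (ep t l w ^+ 2)%:E <= (sigma ^+ 2)%:E * P A)%E) ->
  (forall l, (\int[P]_(w in A) (em t l w ^+ 2)%:E <= (sigma ^+ 2)%:E * P A)%E) ->
  (\int[P]_(w in A) (enorm (step_est g Kk K1 k j U V ep em t h (X w) w) ^+ 2)%:E <=
   (d%:R * (ksqmean Kk * ksqmean K1 / 4 * (2 * Gg ^+ 2 + 8 * sigma ^+ 2)) *
     h ^- (2 * k.+1))%:E * P A)%E.
Proof.
move=> SX mX mA oA epA emA.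
pose c := (2 * h ^+ k.+1) ^- 2.
have c0 : 0 <= c by rewrite invr_ge0 sqr_ge0.
pose xi l w := 2 * Gg ^+ 2 + 4 * ep t l w ^+ 2 + 4 * em t l w ^+ 2.
have xi0 l w : 0 <= xi l w by rewrite !addr_ge0// mulr_ge0 ?sqr_ge0.
pose Y l w := xi l w * \1_A w.
have Y0 l w : 0 <= Y l w by rewrite mulr_ge0.
have mY l b : measurable_fun setT
    (Y l : g_sigma_algebraType (others W N (t, l, b)) -> R).
  apply: measurable_funM; last first.
    apply: (@measurable_indic _ (g_sigma_algebraType (others W N (t, l, b)))).
    exact: oA.
  apply: measurable_funD; [apply: measurable_funD|]; first exact: measurable_cst.
    apply: measurable_funM; first exact: measurable_cst.
    apply: measurable_funX.
    exact: (@measurable_others_noise _ _ _ _ _ W N (t, l, b) (t, l, true)).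
  apply: measurable_funM; first exact: measurable_cst.
  apply: measurable_funX.
  exact: (@measurable_others_noise _ _ _ _ _ W N (t, l, b) (t, l, false)).
have mW := measurable_merge U V; have mN := measurable_merge ep em.
have mYP l : measurable_fun setT (Y l).
  exact: measurable_fun_others mW mN _ _ (mY l true).
have [mKk _ _] := kKk; have [mK1 _ _] := kK1.
have sq (K : R -> R) (Z : {RV P >-> R}) : measurable_fun setT K ->
    measurable_fun setT (fun w => K (Z w) ^+ 2).
  by move=> mK; apply: measurable_funX; exact: measurableT_comp.
pose F l w := Kk (U t l w) ^+ 2 * (K1 (V t l w) ^+ 2 * Y l w).
have F0 l w : 0 <= F l w by rewrite mulr_ge0 ?sqr_ge0// mulr_ge0 ?sqr_ge0.
have mF l : measurable_fun setT (F l).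
  apply: measurable_funM; first exact: sq.
  by apply: measurable_funM; first exact: sq.
have intY l : (\int[P]_w (Y l w)%:E <= (2 * Gg ^+ 2 + 8 * sigma ^+ 2)%:E * P A)%E.
  have mxi (Z : {RV P >-> R}) : measurable_fun A (fun w => (4 * Z w ^+ 2)%:E).
    apply: measurable_funTS; apply/measurable_EFinP.
    by apply: measurable_funM; [exact: measurable_cst|exact: measurable_funX].
  have intsq (Z : {RV P >-> R}) :
      (\int[P]_(w in A) (Z w ^+ 2)%:E <= (sigma ^+ 2)%:E * P A)%E ->
      (\int[P]_(w in A) (4 * Z w ^+ 2)%:E <= (4 * sigma ^+ 2)%:E * P A)%E.
    move=> ZA; under eq_integral do rewrite EFinM.
    rewrite ge0_integralZl//; last 2 first.
    - by apply: measurable_funTS; apply/measurable_EFinP; exact: measurable_funX.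
    - by move=> w _; rewrite lee_fin sqr_ge0.
    by rewrite EFinM -muleA lee_wpmul2l.
  have -> : (\int[P]_w (Y l w)%:E = \int[P]_(w in A) (xi l w)%:E)%E.
    rewrite [RHS]integral_mkcond; apply: eq_integral => w _.
    by rewrite /Y patchE indicE; case: ifP => _; rewrite ?mulr1 ?mulr0.
  under eq_integral do rewrite /xi !EFinD.
  rewrite ge0_integralD//; last 3 first.
  - by move=> w _; rewrite adde_ge0// lee_fin mulr_ge0 ?sqr_ge0.
  - by apply: emeasurable_funD => //; exact: measurable_cst.
  - by move=> w _; rewrite lee_fin mulr_ge0 ?sqr_ge0.
  rewrite ge0_integralD//; last 2 first.
  - by move=> w _; rewrite lee_fin mulr_ge0 ?sqr_ge0.
  - by move=> w _; rewrite lee_fin mulr_ge0 ?sqr_ge0.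
  rewrite integral_cst//.
  have -> : 2 * Gg ^+ 2 + 8 * sigma ^+ 2 =
      2 * Gg ^+ 2 + 4 * sigma ^+ 2 + 4 * sigma ^+ 2 by ring.
  have s0 : (0 <= (4 * sigma ^+ 2)%:E)%E by rewrite lee_fin mulr_ge0 ?sqr_ge0.
  have G0 : (0 <= (2 * Gg ^+ 2)%:E)%E by rewrite lee_fin mulr_ge0 ?sqr_ge0.
  rewrite !EFinD !ge0_muleDl ?adde_ge0//.
  by apply: leeD; [apply: leeD|]; rewrite ?intsq.
apply: (@le_trans _ _ (\int[P]_w (\sum_(l < d) (c * F l w)%:E))%E).
  rewrite integral_mkcond; apply: ge0_le_integral => //.
  - by move=> w _; rewrite patchE; case: ifP => // _; rewrite lee_fin sqr_ge0.
  - apply/(measurable_restrictT _ _).1 => //; apply: measurable_funTS.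
    apply/measurable_EFinP; under eq_fun do rewrite sqr_enorm.
    apply: measurable_sum => i.
    by apply: measurable_funM; exact: measurable_step_est.
  - by apply: emeasurable_sum => l; apply/measurable_EFinP; apply: measurable_funM.
  - move=> w _; rewrite sumEFin patchE; case: ifP => wA; last first.
      by rewrite lee_fin sumr_ge0// => l _; rewrite mulr_ge0.
    rewrite lee_fin sqr_enorm /edot ler_sum// => l _.
    rewrite -expr2 /F /Y indicE wA mulr1.
    exact: (sqr_grad_est_le k j dg gradg Gg0 h0 h1 kKk kK1 l (U t ^~ w)
      (V t ^~ w) (ep t ^~ w) (em t ^~ w) (SX w)).
rewrite ge0_integral_sum//; last 2 first.
- by move=> l; apply/measurable_EFinP; apply: measurable_funM.
- by move=> l w _; rewrite lee_fin mulr_ge0.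
apply: (@le_trans _ _ (\sum_(l < d) c%:E * ((ksqmean Kk * ksqmean K1)%:E *
    ((2 * Gg ^+ 2 + 8 * sigma ^+ 2)%:E * P A)))%E).
  apply: lee_sum => l _; under eq_integral do rewrite EFinM.
  rewrite ge0_integralZl//; last 2 first.
  - exact/measurable_EFinP.
  - by move=> w _; rewrite lee_fin.
  rewrite expectation_kernels//.
  apply: lee_wpmul2l; first by rewrite lee_fin.
  by apply: lee_wpmul2l; rewrite ?lee_fin ?mulr_ge0 ?ksqmean_ge0.
rewrite -(@fineK _ (P A)) ?fin_num_measure// -!EFinM.
rewrite sumEFin lee_fin sumr_const card_ord /c exprMn invfM -exprM (mulnC _ 2%N).
move: (h ^- _) (fine _) => i p.
rewrite le_eqVlt; apply/orP; left; apply/eqP.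
by field.
Qed.

End EstimatorSecondMoment.

(* "E[ . | x_t] for any x_t in Theta" is stated both for the iterate frozen at
   an arbitrary point z of Theta, under the mere second moment bound on the
   noise, and as a genuine conditional expectation given the random iterate
   x t.  In the latter the noise bound has to hold conditionally on x t: the
   noises may depend on each other, so x t may carry information on the noise
   of step t, and the bound on E[eps^2] alone does not suffice. *)
Theorem lemma5p2 (R : realType) (d : nat) (Theta : set 'rV[R]_d)
    (k : nat) (j : 'I_d)
    (alpha beta L Lf G Gg Lbar sigma : R)
    (g : 'rV[R]_d -> R) (Kk K1 : R -> R)
    (dd : measure_display) (Omega : measurableType dd)
    (P : probability Omega R) (T : nat)
    (U V ep em : 'I_T -> 'I_d -> {RV P >-> R})
    (eta h : nat -> R) (x0 : 'rV[R]_d) (x : nat -> Omega -> 'rV[R]_d)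
    (t : 'I_T) :
  compact Theta -> convex_set Theta -> interior Theta !=set0 ->
  0 < alpha -> 1 < beta -> 0 < L -> 0 < Lf -> 0 < G -> 0 < Gg -> 0 < Lbar ->
  in_class Theta j alpha beta k L Lf G Gg Lbar g ->
  deriv_kernel k (sfloor (beta + k%:R)) Kk ->
  grad_kernel (sfloor (beta + k%:R)) K1 ->
  oracle_model sigma U V ep em ->
  (forall s, 0 < eta s) -> (forall s, 0 < h s) ->
  Theta x0 ->
  projected_recursion g Kk K1 k j U V ep em Theta eta h x0 x ->
  h t <= 1 ->
  let bound := 4 * G ^+ 2
    + 4 * d%:R * Cbias Kk K1 L ^+ 2 * h t `^ (2 * (beta - 1))
    + 2 * d%:R * Cvar Kk K1 Lbar Gg sigma * h t ^- (2 * k.+1) in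
  let ghat := step_est g Kk K1 k j U V ep em t (h t) in
  (forall z, Theta z ->
    ('E_P[fun w => (enorm (ghat z w) ^+ 2)%R] <= bound%:E)%E) /\
  ((forall l,
      cond_exp_le P (coords (x t)) (fun w => ep t l w ^+ 2) (sigma ^+ 2) /\
      cond_exp_le P (coords (x t)) (fun w => em t l w ^+ 2) (sigma ^+ 2)) ->
   cond_exp_le P (coords (x t)) (fun w => enorm (ghat (x t w) w) ^+ 2) bound).
Proof.
move=> cTh vTh iTh _ beta1 L0 _ G0 Gg0 _ gC kKk kK1 oracle eta0 hpos Tx0 rec ht1.
move=> bound ghat.
have dg z : differentiable g z.
  have [Cg _] := class_holder gC.
  have b1 : 1 < beta + k%:R by rewrite ltr_wpDr.
  have [_] := sfloorP (lt_trans ltr01 b1).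
  move: Cg; case: (sfloor _) => [_|n [] //].
  by rewrite leNgt b1.
have cg : continuous g by move=> z; exact: differentiable_continuous.
have kernelk : kernel_on Kk by case: kKk.
have kernel1 : kernel_on K1 by case: kK1.
have [mKk _ _] := kernelk; have [mK1 _ _] := kernel1.
have Th0 : Theta !=set0 by exists x0.
have xTh (s : nat) w : (s <= T)%N -> Theta (x s w).
  case: s => [_|s sT]; first by rewrite rec.1.
  by have [] := rec.2 (Ordinal sT) w.
have estimate_le X A := integral_sqr_estimator_le (t := t) (X := X) (A := A)
  k j dg (class_gradg_bound gC) (ltW Gg0)
  (hpos t) ht1 kernelk kernel1 oracle.
pose c : R := d%:R * (ksqmean Kk * ksqmean K1 / 4 *
  (2 * Gg ^+ 2 + 8 * sigma ^+ 2)) * h t ^- (2 * k.+1).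
have le_bound : c <= bound.
  rewrite /bound /c -[leLHS]add0r; apply: lerD.
    by apply: addr_ge0; rewrite ?mulr_ge0 ?powR_ge0// ltW.
  rewrite ler_wpM2r ?invr_ge0 ?exprn_ge0 ?(ltW (hpos t))// /Cvar.
  have K0 : 0 <= ksqmean Kk * ksqmean K1 / 4 by rewrite !mulr_ge0 ?ksqmean_ge0.
  rewrite [leRHS]mulrAC [leRHS]mulrC ler_wpM2l// [leRHS]mulrCA ler_wpM2l//.
  have := sqr_ge0 Gg; have := sqr_ge0 Lbar; have := sqr_ge0 sigma; lra.
split=> [z Tz|noise].
  rewrite unlock; apply: (@le_trans _ _ c%:E); last by rewrite lee_fin.
  have := estimate_le (fun=> z) setT.
  rewrite probability_setT !mule1; apply => //.
  - by move=> l b; exact: (@measurableT _ (g_sigma_algebraType _)).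
  - by move=> l; have := noise_plus oracle t l; rewrite unlock.
  - by move=> l; have := noise_minus oracle t l; rewrite unlock.
have mx i : measurable_fun setT (fun w => x t w 0 i).
  apply: (measurable_iterates cg mKk mK1 (U := U) (V := V) (ep := ep) (em := em)
    cTh vTh Th0 rec.1 rec.2) => //; exact: ltnW.
apply: cond_exp_leP => [//|||A sA].
- under eq_fun do rewrite sqr_enorm.
  apply: measurable_sum => i.
  by apply: measurable_funM; exact: measurable_step_est.
- by move=> w; exact: sqr_ge0.
have mA : measurable A by apply: gen_sigma_measurable sA.
apply: (@le_trans _ _ (c%:E * P A)%E); last by rewrite lee_wpmul2r// lee_fin.
apply: estimate_le => //.
- by move=> w; apply: xTh; exact: ltnW.
- move=> l b; have mxo i : measurable_fun setT ((fun w => x t w 0 i) :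
      g_sigma_algebraType
        (others (merge_families U V) (merge_families ep em) (t, l, b)) -> R).
    apply: (@measurable_iterates _ _ _ (g_sigma_algebraType _) _ _ _ _ _ cg mKk mK1 _ _
      U V ep em _ _ _ _ _ cTh vTh Th0 rec.1 rec.2) => //; last exact: ltnW.
    move=> r q rt.
    have neq b' : (r, q, b') != (t, l, b).
      by rewrite !xpair_eqE -!andbA; apply/nandP; left; rewrite neq_ltn rt.
    split.
    + exact: (measurable_others_coord (W := merge_families U V)
        (N := merge_families ep em) (neq true)).
    + exact: (measurable_others_coord (W := merge_families U V)
        (N := merge_families ep em) (neq false)).
    + exact: (@measurable_others_noise _ _ _ _ _ _ (merge_families ep em) _
        (r, q, true)).
    + exact: (@measurable_others_noise _ _ _ _ _ _ (merge_families ep em) _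
        (r, q, false)).
  exact: (gen_sigma_measurable mxo sA).
- by move=> l; apply: cond_exp_le_integral sA => //;
    [move=> w; exact: sqr_ge0|exact: (noise l).1].
- by move=> l; apply: cond_exp_le_integral sA => //;
    [move=> w; exact: sqr_ge0|exact: (noise l).2].
Qed.
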